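(* Let $n\ge2$ and let $\mathcal P=\{D_i\}_{i\in\mathbb N\cup\{0\}}$ be a packing in $\mathbb R^n$ such that $\partial D_i\cap\partial D_j$ is countable for all $i\ne j$, $i,j\in\mathbb N\cup\{0\}$. Then the residual set $\overline{D_0}\setminus\bigcup_{i\in\mathbb N}D_i$ of $\mathcal P$ is not CNED.
   Context: A packing $\mathcal P$ in $\mathbb R^n$ is a collection of bounded, connected (non-empty) open sets $D_i\subset\mathbb R^n$, $i\in\mathbb N\cup\{0\}$ (with $\mathbb N=\{1,2,\dots\}$), such that $D_i\subset D_0$ for every $i\in\mathbb N$ and $D_i\cap D_j=\emptyset$ for $i,j\in\mathbb N$ with $i\ne j$. The residual set of $\mathcal P$ is $\overline{D_0}\setminus\bigcup_{i\in\mathbb N}D_i$. A path (or curve) in $\mathbb R^n$ is a continuous map $\gamma\colon I\to\mathbb R^n$ with $I\subset\mathbb R$ a compact interval; its trace is $|\gamma|=\gamma(I)$. For a family $\Gamma$ of curves in $\mathbb R^n$, the $n$-modulus is $\mathrm{Mod}_n\Gamma=\inf_\rho\int_{\mathbb R^n}\rho^n$, the infimum over all Borel functions $\rho\colon\mathbb R^n\to[0,\infty]$ with $\int_\gamma\rho\,ds\ge1$ for every rectifiable $\gamma\in\Gamma$ ($\mathrm{Mod}_n\Gamma=\infty$ if there are none). A continuum is a compact connected set. $\Gamma(F_1,F_2;\mathbb R^n)$ is the family of curves $\gamma\colon[a,b]\to\mathbb R^n$ with $\gamma(a)\in F_1$, $\gamma(b)\in F_2$. For $E\subset\mathbb R^n$,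 $\mathcal F_\sigma(E)$ is the family of curves $\gamma$ such that $E\cap|\gamma|$ is countable (finite or infinite). $E$ is CNED if $\mathrm{Mod}_n\Gamma(F_1,F_2;\mathbb R^n)=\mathrm{Mod}_n(\Gamma(F_1,F_2;\mathbb R^n)\cap\mathcal F_\sigma(E))$ for every pair of non-empty, disjoint continua $F_1,F_2\subset\mathbb R^n$. *)

(* Defs.v *)
From HB Require Import structures.
From mathcomp Require Import all_boot all_order all_algebra.
From mathcomp Require Import all_classical all_reals all_analysis measurable_realfun.
Set Implicit Arguments.
Unset Strict Implicit.
Unset Printing Implicit Defensive.
Import Order.TTheory GRing.Theory Num.Theory.
Import numFieldNormedType.Exports.
Local Open Scope classical_set_scope.
Local Open Scope ring_scope.

(* R^n is 'rV[R]_n with the library topology, i.e. the product topology;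
   borelRn is 'rV[R]_n with its Borel sigma-algebra. *)
Notation borelRn R n := (g_sigma_algebraType (@open 'rV[R]_n)).

Section lebesgue_measure_Rn.
Context (R : realType).

Definition consRn (n : nat) (p : measurableTypeR R * borelRn R n) :
  borelRn R n.+1 := row_mx (p.1)%:M (p.2 : 'rV[R]_n).

Definition unconsRn (n : nat) (x : borelRn R n.+1) :
    measurableTypeR R * borelRn R n :=
  ((x : 'rV[R]_n.+1) ord0 ord0, rsubmx (x : 'rV[R]_(1 + n))).

Lemma consRnK n : cancel (@consRn n) (@unconsRn n).
Proof.
move=> [a v]; rewrite /consRn /unconsRn /= row_mxKr; congr pair.
have -> : ord0 = lshift n (ord0 : 'I_1) by apply/val_inj.
by rewrite (@row_mxEl _ 1 1 n) mxE.
Qed.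

Lemma open_borelRn n (U : set 'rV[R]_n) :
  open U -> measurable (U : set (borelRn R n)).
Proof. by move=> oU; apply: sub_sigma_algebra. Qed.

Lemma consRn_ball n (x : 'rV[R]_(1 + n)) (e : R) : 0 < e ->
  @consRn n @^-1` (ball x e : set 'rV[R]_(1 + n)) =
  ball (x ord0 ord0) e `*` (ball (rsubmx x) e : set 'rV[R]_n).
Proof.
move=> e0; apply/seteqP; split => -[a v] /=.
- rewrite /consRn /= => -[_ h]; split.
    have := h ord0 (lshift n ord0).
    rewrite row_mxEl !mxE /= mulr1n.
    by rewrite (_ : lshift n ord0 = ord0)//; apply/val_inj.
  split => // i j; have := h i (rshift 1 j).
  by rewrite row_mxEr !mxE.
- rewrite /consRn /= => -[h1 [_ h2]]; split => // i j.
  have [k ->|k ->] := split_ordP j.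
    by rewrite row_mxEl !ord1 !mxE /= mulr1n (_ : lshift n 0 = ord0)//; apply/val_inj.
  by rewrite row_mxEr; have := h2 i k; rewrite !mxE.
Qed.

Lemma open_rat_balls n (U : set 'rV[R]_n) : open U ->
  U = \bigcup_(q in [set q : 'rV[rat]_n * nat |
        ball (map_mx ratr q.1 : 'rV[R]_n) (q.2.+1%:R^-1 : R) `<=` U])
      (ball (map_mx ratr q.1 : 'rV[R]_n) (q.2.+1%:R^-1 : R)).
Proof.
move=> oU; apply/seteqP; split => [x Ux|x [q/= + xq]]; last exact.
have /nbhs_ballP[e /= e0 xeU] : nbhs x U by exact: open_nbhs_nbhs.
have [k ke] : exists k, k.+1%:R^-1 < e / 2.
  have /ltr_add_invr[k] : 0 < e / 2 by rewrite divr_gt0.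
  by rewrite add0r; exists k.
have /choice[q qP] : forall i, exists q : rat, `|x ord0 i - ratr q| < k.+1%:R^-1.
  move=> i; have h : x ord0 i - k.+1%:R^-1 < x ord0 i + k.+1%:R^-1.
    by rewrite ltrBlDr -addrA ltrDl addr_gt0.
  have [q] := rat_in_itvoo h; rewrite in_itv/= => /andP[q1 q2].
  by exists q; rewrite distrC ltr_distl q1.
have bq : ball (map_mx ratr (\row_i q i) : 'rV[R]_n) (k.+1%:R^-1 : R) x.
  by split => // i j; rewrite !mxE ord1 /ball/= distrC; exact: qP.
exists (\row_i q i, k) => //= y yq; apply: xeU.
have -> : e = e / 2 + e / 2 by rewrite -splitr.
apply: (@ball_triangle _ _ (map_mx ratr (\row_i q i) : 'rV[R]_n)).
  by apply: ball_sym; apply: le_ball bq; exact: ltW.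
by apply: le_ball yq; exact: ltW.
Qed.

Lemma measurable_consRn n : measurable_fun setT (@consRn n).
Proof.
apply: (@measurability _ _ _ (borelRn R n.+1) setT (@consRn n) (@open _)) => // _ [U oU <-].
rewrite setTI (open_rat_balls oU) preimage_bigcup.
rewrite bigcup_mkcond; apply: countable_bigcupT_measurable => // q.
case: ifPn => _; last exact: measurable0.
rewrite [X in measurable X](@consRn_ball n (map_mx ratr q.1)) ?invr_gt0//.
apply: measurableX; first exact: measurable_ball.
apply: open_borelRn. exact: (@ball_open R 'rV[R]_n).
Qed.

Lemma measurable_unconsRn n : measurable_fun setT (@unconsRn n).
Proof.
apply/measurable_fun_pairP; split.
- apply: (measurability _ (RGenOpens.measurableE R)).
  move=> _ [_ [a [b ->] <-]]; rewrite setTI; apply: open_borelRn.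
  have /continuousP : continuous (fun x : 'rV[R]_n.+1 => x ord0 ord0).
    exact: coord_continuous.
  by apply; exact: interval_open.
- apply: (@measurability _ _ _ (borelRn R n) setT (snd \o @unconsRn n)
    (@open _)) => // _ [U oU <-].
  rewrite setTI; apply: open_borelRn.
  have /continuousP : continuous (fun x : 'rV[R]_(1 + n) => rsubmx x).
    move=> x A /nbhs_ballP[e /= e0 xeA]; apply/nbhs_ballP; exists e => //= y.
    move=> [_ xy]; apply: xeA; split => // i j; rewrite !mxE; exact: xy.
  exact.
Qed.

Lemma lebesgue_consRn_sigma_finite n
    (mu : {sigma_finite_measure set (borelRn R n) -> \bar R}) :
  sigma_finite setT (pushforward (lebesgue_measure \x mu)%E (@consRn n)).
Proof.
have /sigma_finiteP[F [TF ndF Foo]] := sigma_finiteT (@lebesgue_measure R).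
have /sigma_finiteP[G [TG ndG Goo]] := sigma_finiteT mu.
exists (fun k => @unconsRn n @^-1` (F k `*` G k)) => [|k].
  rewrite -preimage_bigcup; apply/esym/seteqP; split => // x _ /=.
  have [j _ Fj] : (\bigcup_i F i) (unconsRn x).1 by rewrite -TF.
  have [k _ Gk] : (\bigcup_i G i) (unconsRn x).2 by rewrite -TG.
  exists (maxn j k) => //; split => /=.
    by apply: (subsetPset _ _ (ndF _ _ (leq_maxl j k))).
  by apply: (subsetPset _ _ (ndG _ _ (leq_maxr j k))).
have [mF Fk] := Foo k; have [mG Gk] := Goo k; split.
  by rewrite -[X in measurable X]setTI; apply: measurable_unconsRn => //;
    exact: measurableX.
rewrite /pushforward -comp_preimage (_ : _ \o _ = id); last first.
  exact/funext/consRnK.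
by rewrite preimage_id product_measure1E// lte_mul_pinfty// ge0_fin_numE.
Qed.

Definition lebesgue_consRn n
    (mu : {sigma_finite_measure set (borelRn R n) -> \bar R}) :
  set (borelRn R n.+1) -> \bar R :=
  pushforward (lebesgue_measure \x mu)%E (@consRn n).

HB.instance Definition _ n mu := Measure.copy (@lebesgue_consRn n mu)
  (measure_function_pushforward__canonical__measure_function_Measure
     (lebesgue_measure \x mu)%E (@measurable_consRn n)).
HB.instance Definition _ n mu := Measure_isSigmaFinite.Build _ _ _
  (@lebesgue_consRn n mu) (lebesgue_consRn_sigma_finite mu).

(* The n-fold product of the Lebesgue measure on R; R^0 is a point of mass 1. *)
Fixpoint lebesgue_Rn n : {sigma_finite_measure set (borelRn R n) -> \bar R} :=
  if n is m.+1 then @lebesgue_consRn m (lebesgue_Rn m)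
  else @dirac _ (borelRn R 0) 0 R.

End lebesgue_measure_Rn.

(* The library norm on 'rV[R]_n is the sup norm; lengths of curves need the
   Euclidean one. *)
Definition enorm (R : realType) (n : nat) (x : 'rV[R]_n) : R :=
  Num.sqrt (\sum_(i < n) x ord0 i ^+ 2).

Section curves.
Context (R : realType) (n : nat).

(* A curve is given by a total function on R of which only the restriction to
   [curve_lo, curve_hi] is meaningful. *)
Record curve := Curve {
  curve_fun :> R -> 'rV[R]_n ;
  curve_lo : R ;
  curve_hi : R ;
  curve_lo_le_hi : curve_lo <= curve_hi ;
  curve_continuous :
    {within `[curve_lo, curve_hi], continuous curve_fun} }.

Implicit Types (g : curve) (G : set curve).

Definition trace g : set 'rV[R]_n := g @` `[curve_lo g, curve_hi g].

(* Vector-valued analogues of the library's [variation] and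
   [total_variation]. *)
Definition inscribed_length (f : R -> 'rV[R]_n) (a b : R) (s : seq R) : R :=
  \sum_(0 <= k < size s)
    enorm (f (nth b (a :: s) k.+1) - f (nth b (a :: s) k)).

Definition arc_length (f : R -> 'rV[R]_n) (a b : R) : \bar R :=
  ereal_sup [set (inscribed_length f a b s)%:E | s in itv_partition a b].

Definition curve_length g : \bar R := arc_length g (curve_lo g) (curve_hi g).

Definition rectifiable g : Prop := (curve_length g < +oo)%E.

(* Arclength parametrization of a rectifiable curve: for s in
   [0, curve_length g], the common value g t of all t such that g has length s
   on [curve_lo g, t]. *)
Definition arclength_param g (s : R) : 'rV[R]_n :=
  xget (g (curve_lo g))
    (g @` [set t | t \in `[curve_lo g, curve_hi g] /\
                   arc_length g (curve_lo g) t = s%:E]).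

Definition line_integral g (rho : 'rV[R]_n -> \bar R) : \bar R :=
  (\int[lebesgue_measure]_(s in `[0%R, fine (curve_length g)])
     rho (arclength_param g s))%E.

Definition admissible G (rho : borelRn R n -> \bar R) : Prop :=
  [/\ measurable_fun setT rho,
      forall x, (0 <= rho x)%E &
      forall g, G g -> rectifiable g -> (1 <= line_integral g rho)%E].

Definition modulus G : \bar R :=
  ereal_inf [set (\int[lebesgue_Rn R n]_x (rho x ^+ n))%E |
             rho in admissible G].

Definition curves_joining (F1 F2 : set 'rV[R]_n) : set curve :=
  [set g : curve | F1 (g (curve_lo g)) /\ F2 (g (curve_hi g))].

Definition countably_meeting (E : set 'rV[R]_n) : set curve :=
  [set g : curve | countable (E `&` trace g)].

Definition continuum (F : set 'rV[R]_n) : Prop := compact F /\ connected F.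

Definition CNED (E : set 'rV[R]_n) : Prop :=
  forall F1 F2 : set 'rV[R]_n,
    F1 !=set0 -> F2 !=set0 -> continuum F1 -> continuum F2 ->
    F1 `&` F2 = set0 ->
    modulus (curves_joining F1 F2) =
    modulus (curves_joining F1 F2 `&` countably_meeting E).

Record packing (D : nat -> set 'rV[R]_n) : Prop := Packing {
  packing_open : forall i, open (D i) ;
  packing_nonempty : forall i, D i !=set0 ;
  packing_connected : forall i, connected (D i) ;
  packing_bounded : forall i, bounded_set (D i) ;
  packing_sub : forall i, (0 < i)%N -> D i `<=` D 0%N ;
  packing_disjoint : forall i j, (0 < i)%N -> (0 < j)%N -> i != j ->
    D i `&` D j = set0 }.

Definition residual_set (D : nat -> set 'rV[R]_n) : set 'rV[R]_n :=
  closure (D 0%N) `\` \bigcup_(i in [set i | (0 < i)%N]) D i.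

Definition boundary (A : set 'rV[R]_n) : set 'rV[R]_n :=
  closure A `\` interior A.

End curves.

(* Main.v *)
Require Import Defs.
From mathcomp Require Import all_boot all_order all_algebra.
From mathcomp Require Import all_classical all_reals all_analysis.
From mathcomp Require Import measurable_realfun ring lra.
Import Order.TTheory GRing.Theory Num.Theory.
Import numFieldNormedType.Exports.
Local Open Scope classical_set_scope.
Local Open Scope ring_scope.
Set Implicit Arguments.
Unset Strict Implicit.
Unset Printing Implicit Defensive.

(** The proof exhibits two disjoint continua between which the residual set
    makes a difference: a closed ball F1 inside the first packed domain, and a
    translate F2 of it that lies outside the closure of the container.

    The family of all curves joining F1 to F2 has positive modulus
    (modulus_joining_gt0): it contains the segments joining each point of the
    middle section of F1 to its translate, and on each of them an admissible
    density has integral at least 1.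

    The curves of this family that meet the residual set in a countable set
    have modulus zero.  The packed domains and the exterior of the container
    are disjoint open sets which together form the complement of the residual
    set.  If such a curve avoided the set C of all common points of two
    boundaries, the closures of these open sets would cut it into disjoint
    closed sets, the rest of it being countable; so a segment would be a
    countable disjoint union of closed sets, at least two of them nonempty,
    against a theorem of Sierpinski (closed_fibre_constant).  Hence every such
    curve passes through C (curve_meets_common_boundary), which is countable
    by hypothesis and does not meet the open set in which the curves start.  As
    n >= 2, nonconstant curves through a given point have modulus zero, and so
    have those through a countable set (modulus_through_countable_le).

    The estimate at a point relies on the arclength parametrization being
    1-Lipschitz and defined on the whole interval from 0 to the length of the
    curve.  The latter amounts to the continuity of arclength, which follows
    from that of the total variations of the coordinates. *)

(** * Colourings of an interval with closed colour classes *)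

Lemma closed_has_max (R : realType) (A : set R) (b : R) :
  closed A -> A !=set0 -> (forall x, A x -> x <= b) ->
  exists2 m, A m & forall x, A x -> x <= m.
Proof.
move=> cA A0 Ab; have uA : has_ubound A by exists b.
exists (sup A); last by move=> x Ax; exact: ub_le_sup.
by have := closure_sup A0 uA; rewrite -((closure_id A).1 cA).
Qed.

Lemma closed_has_min (R : realType) (A : set R) (a : R) :
  closed A -> A !=set0 -> (forall x, A x -> a <= x) ->
  exists2 m, A m & forall x, A x -> m <= x.
Proof.
move=> cA [x0 Ax0] aA.
have [||x|m Am mA] := @closed_has_max R (-%R @^-1` A) (- a).
- by apply: preimage_closed => // x _; exact: opp_continuous.
- by exists (- x0); rewrite /= opprK.
- by move=> /aA; rewrite lerNr.
- exists (- m) => // x Ax; rewrite lerNl; apply: mA.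
  by rewrite /= opprK.
Qed.

Section interval_colouring.
Variables (R : realType) (f : R -> nat) (a b : R).
Hypothesis closed_fibre : forall k, closed (`[a, b] `&` f @^-1` [set k]).

Let closed_fibre_in c d k : a <= c -> d <= b ->
  closed (`[c, d] `&` f @^-1` [set k]).
Proof.
move=> ac db.
rewrite [X in closed X](_ : _ = `[c, d] `&` (`[a, b] `&` f @^-1` [set k])).
  by apply: closedI => //; exact: interval_closed.
apply/seteqP; split => [t [] /=|t [tcd [_ ft]]]; last by split.
rewrite !in_itv/= => /andP[ct td] ft; split; rewrite /= ?in_itv/= ?ct//.
by split => //=; rewrite (le_trans ac ct) (le_trans td db).
Qed.

(** On one of the two ends the colour is not k.  Walking from that end, the
    first point m of colour k is reached only after some other colour change:
    the class of the starting colour is closed and does not contain m, so it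
    cannot fill everything before m. *)
Let avoid_colour c d k : a <= c -> c <= d -> d <= b -> f c != f d ->
  exists p : R * R, [/\ c <= p.1, p.1 <= p.2, p.2 <= d, f p.1 != f p.2 &
    forall t, p.1 <= t <= p.2 -> f t != k].
Proof.
move=> ac cd db fcd.
have [[t0 t0k]|nok] := pselect ((`[c, d] `&` f @^-1` [set k]) !=set0); last first.
  exists (c, d); split => //= t tcd; apply/negP => /eqP ftk.
  by apply: nok; exists t; split => //=; rewrite in_itv.
have [fck|fck] := eqVneq (f c) k.
  have [||t|m [/= mcd fm] mmax] :=
    @closed_has_max R (`[c, d] `&` f @^-1` [set k]) d.
  - exact: closed_fibre_in.
  - by exists t0.
  - by case => /=; rewrite in_itv/= => /andP[].
  move: mcd; rewrite in_itv/= => /andP[cm md].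
  have aft t : m < t -> t <= d -> f t != k.
    move=> mt td; apply/negP => /eqP ft.
    have : t <= m by apply: mmax; split => //=; rewrite in_itv/= td (le_trans cm (ltW mt)).
    by rewrite leNgt mt.
  (* m is the last point of colour k: look for a colour change after m *)
  have [[d' [md' d'd fd']]|nod'] :=
      pselect (exists d', [/\ m < d', d' <= d & f d' != f d]).
    exists (d', d); split => //=; first exact: le_trans cm (ltW md').
    by move=> t /andP[t1 t2]; apply: aft => //; exact: lt_le_trans t1.
  exfalso.
  have md2 : m < d.
    by rewrite lt_neqAle md andbT; apply: contra fcd => /eqP <-; rewrite fm fck.
  have [||t|m' [/= m'cd fm'] m'min] :=
    @closed_has_min R (`[m, d] `&` f @^-1` [set f d]) m.
  - by apply: closed_fibre_in => //; exact: le_trans cm.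
  - by exists d; split => //=; rewrite in_itv/= lexx (ltW md2).
  - by case => /=; rewrite in_itv/= => /andP[].
  move: m'cd; rewrite in_itv/= => /andP[mm' m'd].
  have mm'2 : m < m'.
    rewrite lt_neqAle mm' andbT; apply: contra fcd => /eqP mm'e.
    by rewrite fck -fm mm'e fm'.
  pose d' := (m + m') / 2; have [e1 e2] := midf_lt mm'2.
  have e3 := le_trans (ltW e2) m'd.
  have [fd'|fd'] := eqVneq (f d') (f d); last by apply: nod'; exists d'; split.
  have : m' <= d' by apply: m'min; split => //=; rewrite in_itv/= e3 (ltW e1).
  by rewrite leNgt e2.
have [||t|m [/= mcd fm] mmax] :=
    @closed_has_min R (`[c, d] `&` f @^-1` [set k]) c.
- exact: closed_fibre_in.
- by exists t0.
- by case => /=; rewrite in_itv/= => /andP[].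
move: mcd; rewrite in_itv/= => /andP[cm md].
have bef t : c <= t -> t < m -> f t != k.
  move=> ct tm; apply/negP => /eqP ft.
  have : m <= t by apply: mmax; split => //=; rewrite in_itv/= ct (le_trans (ltW tm)).
  by rewrite leNgt tm.
(* m is the first point of colour k: look for a colour change before m *)
have [[c' [cc' c'm fc']]|noc'] :=
    pselect (exists c', [/\ c <= c', c' < m & f c != f c']).
  exists (c, c'); split => //=; first exact: le_trans (ltW c'm) md.
  by move=> t /andP[t1 t2]; apply: bef => //; exact: le_lt_trans t2 _.
exfalso.
have cm2 : c < m.
  by rewrite lt_neqAle cm andbT; apply: contra fck => /eqP ->; rewrite fm.
have [||t|m' [/= m'cd fm'] m'max] :=
    @closed_has_max R (`[c, m] `&` f @^-1` [set f c]) m.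
- by apply: closed_fibre_in => //; exact: le_trans md _.
- by exists c; split => //=; rewrite in_itv/= lexx.
- by case => /=; rewrite in_itv/= => /andP[].
move: m'cd; rewrite in_itv/= => /andP[cm' m'm].
have m'm2 : m' < m.
  rewrite lt_neqAle m'm andbT; apply: contra fck => /eqP mm'e.
  by rewrite -fm -mm'e fm'.
pose c' := (m' + m) / 2; have [e1 e2] := midf_lt m'm2.
have e3 := le_trans cm' (ltW e1).
have [fc'|fc'] := eqVneq (f c) (f c'); last by apply: noc'; exists c'; split.
have : c' <= m' by apply: m'max; split => //=; rewrite in_itv/= e3 (ltW e2).
by rewrite leNgt e1.
Qed.

(** The theorem of Sierpinski, for an interval: a continuum is not a countable
    union of at least two disjoint nonempty closed sets.  If the two ends of an
    interval have different colours, avoid_colour yields nested two-coloured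
    intervals of which the k-th avoids colour k; a point common to all of them
    would have no colour. *)
Lemma closed_fibre_constant : forall x y : R,
  a <= x -> x <= y -> y <= b -> f x = f y.
Proof.
move=> x y ax xy yb; apply/eqP; apply/negPn/negP => fxy.
pose good p := [/\ a <= p.1, p.1 <= p.2, p.2 <= b & f p.1 != f p.2].
have /choice[nxt nxtP] : forall q : nat * (R * R), exists p : R * R, good q.2 ->
    [/\ good p, q.2.1 <= p.1, p.2 <= q.2.2 &
        forall t, p.1 <= t <= p.2 -> f t != q.1].
  move=> [k [c d]]; have [[/= g1 g2 g3 g4]|] := pselect (good (c, d)); last by exists (c, d).
  have [p [p1 p2 p3 p4 p5]] := @avoid_colour c d k g1 g2 g3 g4.
  exists p => _; split => //; split => //; first exact: le_trans p1.
  exact: le_trans p3 g3.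
(* the n-th step removes the colour n *)
pose p := fix p n := if n is m.+1 then nxt (m, p m) else (x, y).
have pgood n : good (p n).
  by elim: n => [//|n ih]; have [] := nxtP (n, p n) ih.
have pl m n : (m <= n)%N -> (p m).1 <= (p n).1 /\ (p n).2 <= (p m).2.
  elim: n => [|n ih]; first by rewrite leqn0 => /eqP ->.
  rewrite leq_eqVlt => /predU1P[->//|]; rewrite ltnS => /ih[h1 h2].
  have [_ h3 h4 _] := nxtP (n, p n) (pgood n).
  by split; [exact: le_trans h1 h3|exact: le_trans h4 h2].
pose A := range (fun n => (p n).1).
have A0 : A !=set0 by exists (p 0%N).1; exists 0%N.
have Aub n : ubound A (p n).2.
  move=> _ [m _ <-]; have [mn|/ltnW nm] := leqP m n.
    by apply: le_trans (pl _ _ mn).1 _; have [] := pgood n.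
  by apply: le_trans (pl _ _ nm).2; have [] := pgood m.
pose t := sup A.
have tlo n : (p n).1 <= t by apply: ub_le_sup; [exists (p 0%N).2; exact: Aub|exists n].
have thi n : t <= (p n).2 by apply: ge_sup => //; exact: Aub.
have [_ _ _ /(_ t)] := nxtP (f t, p (f t)) (pgood (f t)).
by move=> /(_ _)/eqP; apply => //; apply/andP; split; [exact: (tlo (f t).+1)|exact: (thi (f t).+1)].
Qed.

End interval_colouring.

(** * The Euclidean norm and the length of curves *)

Section euclidean_norm.
Variables (R : realType) (n : nat).
Implicit Types x y : 'rV[R]_n.

Lemma enorm_ge0 x : 0 <= enorm x.
Proof. exact: sqrtr_ge0. Qed.

Lemma enorm0 : enorm (0 : 'rV[R]_n) = 0.
Proof.
rewrite /enorm big1 ?sqrtr0// => i _.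
by rewrite mxE expr0n.
Qed.

Let sq_ge0 x : 0 <= \sum_(i < n) x ord0 i ^+ 2.
Proof. by apply: sumr_ge0 => i _; exact: sqr_ge0. Qed.

Let enorm_sq x : enorm x ^+ 2 = \sum_(i < n) x ord0 i ^+ 2.
Proof. by rewrite sqr_sqrtr. Qed.

Lemma coord_le_enorm x i : `|x ord0 i| <= enorm x.
Proof.
rewrite -[leLHS]sqrtr_sqr ler_sqrt// (bigD1 i)//= lerDl.
by apply: sumr_ge0 => j _; exact: sqr_ge0.
Qed.

Lemma mx_norm_le_enorm x : `|x| <= enorm x.
Proof.
rewrite [leLHS]/Num.norm /= mx_normrE; apply/bigmax_leP; split => [|[i j] _].
  exact: enorm_ge0.
by rewrite /= ord1 coord_le_enorm.
Qed.

Lemma enorm_le_sum x : enorm x <= \sum_(i < n) `|x ord0 i|.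
Proof.
have s0 : 0 <= \sum_(i < n) `|x ord0 i| by apply: sumr_ge0.
rewrite -[leRHS](ger0_norm s0) -sqrtr_sqr ler_sqrt ?sqr_ge0//.
have h (s : seq 'I_n) : \sum_(i <- s) x ord0 i ^+ 2 <= (\sum_(i <- s) `|x ord0 i|) ^+ 2.
  elim: s => [|i s ih]; first by rewrite !big_nil expr0n.
  rewrite !big_cons sqrrD -real_normK ?num_real// -addrA lerD2l.
  apply: le_trans ih _; rewrite lerDr mulrn_wge0// mulr_ge0//.
  exact: sumr_ge0.
exact: h.
Qed.

Lemma ler_enormD x y : enorm (x + y) <= enorm x + enorm y.
Proof.
(* Cauchy-Schwarz, from the sum of the squares of |y| x_i - |x| y_i *)
have cs : \sum_(i < n) x ord0 i * y ord0 i <= enorm x * enorm y.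
  have [x0|x0] := eqVneq (enorm x) 0.
    rewrite x0 mul0r big1// => i _; have := coord_le_enorm x i.
    by rewrite x0 normr_le0 => /eqP ->; rewrite mul0r.
  have [y0|y0] := eqVneq (enorm y) 0.
    rewrite y0 mulr0 big1// => i _; have := coord_le_enorm y i.
    by rewrite y0 normr_le0 => /eqP ->; rewrite mulr0.
  have ab0 : 0 < enorm x * enorm y by rewrite mulr_gt0// lt_neqAle eq_sym ?x0 ?y0 enorm_ge0.
  rewrite -(ler_pM2r ab0).
  have : \sum_(i < n) (enorm y * x ord0 i - enorm x * y ord0 i) ^+ 2 >= 0.
    by apply: sumr_ge0 => i _; exact: sqr_ge0.
  have -> : \sum_(i < n) (enorm y * x ord0 i - enorm x * y ord0 i) ^+ 2 =
      enorm y ^+ 2 * (\sum_(i < n) x ord0 i ^+ 2)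
      + enorm x ^+ 2 * (\sum_(i < n) y ord0 i ^+ 2)
      - (enorm x * enorm y) *+ 2 * \sum_(i < n) x ord0 i * y ord0 i.
    rewrite !mulr_sumr -big_split -sumrB /=.
    by apply: eq_bigr => i _; ring.
  by rewrite -!enorm_sq; nra.
rewrite -[leRHS]ger0_norm ?addr_ge0 ?enorm_ge0// -sqrtr_sqr ler_sqrt ?sqr_ge0//.
rewrite sqrrD !enorm_sq.
under eq_bigr do rewrite mxE sqrrD.
by rewrite !big_split/= -mulr2n lerD2r lerD2l lerMn2r cs.
Qed.

End euclidean_norm.

Section arc_length.
Variables (R : realType) (n : nat) (f : R -> 'rV[R]_n).

Fixpoint polygon_length a (s : seq R) : R :=
  if s is x :: t then enorm (f x - f a) + polygon_length x t else 0.

Lemma inscribed_lengthE a b s : inscribed_length f a b s = polygon_length a s.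
Proof.
rewrite /inscribed_length; elim: s a => [|x s ih] a; first by rewrite big_nil.
by rewrite /= big_nat_recl//= ih.
Qed.

Lemma polygon_length_le a b s : itv_partition a b s ->
  ((polygon_length a s)%:E <= arc_length f a b)%E.
Proof.
by move=> abs; apply: ereal_sup_ubound; exists s => //; rewrite inscribed_lengthE.
Qed.

Lemma arc_length_le a b (M : \bar R) :
  (forall s, itv_partition a b s -> ((polygon_length a s)%:E <= M)%E) ->
  (arc_length f a b <= M)%E.
Proof.
by move=> h; apply: ge_ereal_sup => _ [s abs <-]; rewrite inscribed_lengthE; exact: h.
Qed.

Lemma chord_le_arc_length a b : a <= b -> ((enorm (f b - f a))%:E <= arc_length f a b)%E.
Proof.
rewrite le_eqVlt => /predU1P[<-|ab].
  by rewrite subrr enorm0; apply: (@polygon_length_le a a [::]); split => /=.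
have := @polygon_length_le a b [:: b] (itv_partition1 ab).
by rewrite /= addr0.
Qed.

Lemma arc_length_ge0 a b : a <= b -> (0 <= arc_length f a b)%E.
Proof. by move=> ab; rewrite (le_trans _ (chord_le_arc_length ab))// lee_fin enorm_ge0. Qed.

(** The part of additivity of length that concerns chords; it makes the
    arclength parametrization 1-Lipschitz. *)
Lemma arc_length_chord a c b : a <= c -> c <= b ->
  (arc_length f a c + (enorm (f b - f c))%:E <= arc_length f a b)%E.
Proof.
move=> ac; rewrite le_eqVlt => /predU1P[<-|cb]; first by rewrite subrr enorm0 adde0.
rewrite -leeBrDr//; apply: arc_length_le => s acs; rewrite leeBrDr// -EFinD.
apply: (@le_trans _ _ (polygon_length a (rcons s b))%:E).
  rewrite lee_fin; case: acs => _ /eqP <-.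
  elim: s a {ac} => [|x s ih] a /=; first by rewrite add0r addr0.
  by rewrite -addrA lerD2l.
apply: polygon_length_le; rewrite -cats1; apply: itv_partition_cat acs _.
exact: itv_partition1.
Qed.

Lemma arc_length_split a c b : a <= c -> c <= b ->
  (arc_length f a b <= arc_length f a c + arc_length f c b)%E.
Proof.
move=> ac cb; apply: arc_length_le => s.
elim: s a ac => [|x s ih] a ac abs.
  by rewrite adde_ge0// arc_length_ge0.
have /= abs' := itv_partition_cons abs.
have ax : a < x by case: abs => /= /andP[].
have xb := itv_partition_le abs'.
have [xc|cx] := leP x c.
  rewrite /= EFinD (le_trans (leeD2l _ (ih x xc abs')))// addeA leeD2r//.
  (* a partition of [x, c] together with the chord from a to x is one of [a, c] *)
  rewrite addeC -leeBrDr//; apply: arc_length_le => t xct; rewrite leeBrDr// -EFinD.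
  rewrite addrC; apply: (@polygon_length_le a c (x :: t)).
  by case: xct => p1 p2; split => //=; rewrite ax.
(* c falls in the first step: insert it as a vertex of the polygon *)
apply: (@le_trans _ _ (enorm (f c - f a) + (enorm (f x - f c) + polygon_length x s))%:E).
  rewrite /= lee_fin addrA lerD2r.
  by rewrite -(subrKA (f c)) [leRHS]addrC ler_enormD.
rewrite EFinD leeD ?chord_le_arc_length//.
by apply: (@polygon_length_le c b (x :: s)); case: abs' => p1 p2; split => //=; rewrite cx.
Qed.

Lemma variation_le_polygon a b s i : itv_partition a b s ->
  variation a b (fun t => f t ord0 i) s <= polygon_length a s.
Proof.
move=> abs; rewrite -(inscribed_lengthE a b); apply: ler_sum => k _ /=.
by have := coord_le_enorm (f (nth b (a :: s) k.+1) - f (nth b (a :: s) k)) i; rewrite !mxE.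
Qed.

(** Together with the continuity of the total variation of a real function,
    this gives the continuity of arclength. *)
Lemma arc_length_le_total_variation a b :
  (arc_length f a b <= \sum_(i < n) total_variation a b (fun t => f t ord0 i))%E.
Proof.
apply: arc_length_le => s abs.
apply: (@le_trans _ _ (\sum_(i < n) variation a b (fun t => f t ord0 i) s)%:E).
  rewrite -(inscribed_lengthE a b) lee_fin exchange_big/=; apply: ler_sum => k _.
  apply: le_trans (enorm_le_sum _) _.
  by apply: ler_sum => i _; rewrite !mxE.
rewrite -sumEFin; apply: lee_sum => i _; apply: ereal_sup_ubound.
by exists (variation a b (fun t => f t ord0 i) s) => //; exists s.
Qed.

Lemma finite_arc_length_bounded_variation a b i : (arc_length f a b < +oo)%E -> a <= b ->
  bounded_variation a b (fun t => f t ord0 i).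
Proof.
move=> fin ab; exists (fine (arc_length f a b)) => _ [s abs <-].
apply: le_trans (variation_le_polygon i abs) _.
rewrite -lee_fin fineK; first exact: polygon_length_le.
by rewrite ge0_fin_numE// arc_length_ge0.
Qed.

End arc_length.

(** * The arclength parametrization of a rectifiable curve *)

Lemma arc_lengthxx (R : realType) n (f : R -> 'rV[R]_n) a : arc_length f a a = 0%E.
Proof.
apply/eqP; rewrite eq_le arc_length_ge0// andbT.
by apply: arc_length_le => s /itv_partitionxx ->.
Qed.

Section arclength_parametrization.
Variables (R : realType) (n : nat) (g : curve R n).
Hypothesis rg : rectifiable g.

Let a := curve_lo g.
Let b := curve_hi g.
Let ab : a <= b := curve_lo_le_hi g.

Definition arclength (t : R) : R := fine (arc_length g a t).

Lemma arclength_fin t : a <= t -> t <= b -> arc_length g a t \is a fin_num.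
Proof.
move=> ta tb; rewrite ge0_fin_numE ?arc_length_ge0//; apply: le_lt_trans rg.
by apply: le_trans (arc_length_chord g ta tb); rewrite leeDl// lee_fin enorm_ge0.
Qed.

Lemma arclength_lo : arclength a = 0.
Proof. by rewrite /arclength arc_lengthxx. Qed.

Lemma arclength_chord s t : a <= s -> s <= t -> t <= b ->
  enorm (g t - g s) <= arclength t - arclength s.
Proof.
move=> as_ st tb; have sb := le_trans st tb; have at_ := le_trans as_ st.
rewrite lerBrDl -lee_fin EFinD /arclength !fineK ?arclength_fin//.
exact: arc_length_chord.
Qed.

Lemma arclength_nondecreasing s t : a <= s -> s <= t -> t <= b ->
  arclength s <= arclength t.
Proof.
move=> h1 h2 h3; rewrite -subr_ge0; apply: le_trans (arclength_chord h1 h2 h3).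
exact: enorm_ge0.
Qed.

Lemma arclength_lipschitz s t : a <= s -> s <= b -> a <= t -> t <= b ->
  `|g t - g s| <= `|arclength t - arclength s|.
Proof.
wlog st : s t / s <= t => [H|] as_ sb at_ tb.
  have [st|ts] := leP s t; first exact: H.
  by rewrite distrC [leRHS]distrC; apply: H => //; exact: ltW.
apply: le_trans (mx_norm_le_enorm _) _.
exact: le_trans (arclength_chord as_ st tb) (ler_norm _).
Qed.

(** The choice made by arclength_param is immaterial: two parameters with the
    same arclength have the same image, because chords are shorter than arcs. *)
Lemma arclength_paramE t : a <= t -> t <= b ->
  arclength_param g (arclength t) = g t.
Proof.
move=> at_ tb; rewrite /arclength_param; case: xgetP => [_ -> [u /=[]]|].
  rewrite in_itv/= => /andP[au ub] uE <-.
  apply/eqP; rewrite -subr_eq0 -normr_le0.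
  apply: le_trans (arclength_lipschitz at_ tb au ub) _.
  by rewrite {1}/arclength -/a uE /= subrr normr0.
move=> /(_ (g t)); case; exists t => //=; split; first by rewrite in_itv/= at_.
by rewrite /arclength fineK// arclength_fin.
Qed.

(** The increments of arclength are dominated by those of T, the sum of the
    total variations of the coordinates, which is continuous. *)
Lemma continuous_arclength : {within `[a, b], continuous arclength}.
Proof.
have bv i : bounded_variation a b (fun t => g t ord0 i).
  exact: finite_arc_length_bounded_variation rg ab.
have [alb|] := ltP a b; last first.
  move=> ba; have {}ba : b = a by apply/eqP; rewrite eq_le ba ab.
  by rewrite ba set_itv1; exact: continuous_subspace1.
pose T t := \sum_(i < n) fine (total_variation a t (fun t => g t ord0 i)).
have Tc : {within `[a, b], continuous T}.
  apply: continuous_big => [|i _]; first exact: add_continuous.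
  apply: total_variation_continuous => //.
  move=> x; apply: (@continuous_comp (subspace `[a, b]) _ _ g
    (fun v : 'rV[R]_n => v ord0 i)); last exact: coord_continuous.
  exact: curve_continuous.
have aT s t : a <= s -> s <= t -> t <= b -> arclength t - arclength s <= T t - T s.
  move=> as_ st tb; have sb := le_trans st tb; have at_ := le_trans as_ st.
  have fs i : total_variation a s (fun t => g t ord0 i) \is a fin_num.
    by apply/bounded_variationP => //; exact: bounded_variationl (bv i).
  have ft i : total_variation a t (fun t => g t ord0 i) \is a fin_num.
    by apply/bounded_variationP => //; exact: bounded_variationl (bv i).
  rewrite lerBlDl -lee_fin /arclength fineK ?arclength_fin//.
  apply: le_trans (arc_length_split g as_ st) _.
  rewrite EFinD fineK ?arclength_fin// leeD2l//.
  apply: le_trans (arc_length_le_total_variation _ _ _) _.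
  rewrite /T -sumrB -sumEFin; apply: lee_sum => i _.
  rewrite EFinB !fineK// leeBrDr// addeC.
  by rewrite -(total_variationD _ as_ st).
apply/subspace_continuousP => x xab.
have /subspace_continuousP/(_ x xab)/cvgrPdist_lt Tx := Tc.
apply/cvgrPdist_lt => e e0; apply: filterS2 (withinT _ _) (Tx e e0) => y yab.
apply: le_lt_trans.
move: xab yab; rewrite /= !in_itv/= => /andP[ax xb] /andP[ay yb].
have [xy|/ltW yx] := leP x y.
  rewrite distrC [leRHS]distrC !ger0_norm ?aT//.
    by apply: le_trans (aT _ _ ax xy yb); rewrite subr_ge0 arclength_nondecreasing.
  by rewrite subr_ge0 arclength_nondecreasing.
rewrite !ger0_norm ?aT//.
  by apply: le_trans (aT _ _ ay yx xb); rewrite subr_ge0 arclength_nondecreasing.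
by rewrite subr_ge0 arclength_nondecreasing.
Qed.

(** Without this, arclength_param could take its default value on a set of
    positive measure, and line integrals would not see the curve. *)
Lemma arclength_surjective s : 0 <= s -> s <= fine (curve_length g) ->
  exists t, [/\ a <= t, t <= b & arclength t = s].
Proof.
move=> s0 sL; have [|t] := IVT ab continuous_arclength (v := s).
  rewrite arclength_lo min_l ?max_r ?s0//.
    by rewrite /arclength fine_ge0// arc_length_ge0.
  by rewrite /arclength fine_ge0// arc_length_ge0.
by rewrite in_itv/= => /andP[at_ tb] ts; exists t.
Qed.

Lemma arclength_param_lipschitz s t : 0 <= s -> s <= fine (curve_length g) ->
  0 <= t -> t <= fine (curve_length g) ->
  `|arclength_param g t - arclength_param g s| <= `|t - s|.
Proof.
move=> s0 sL t0 tL.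
have [u [au ub <-]] := arclength_surjective s0 sL.
have [v [av vb <-]] := arclength_surjective t0 tL.
by rewrite !arclength_paramE// arclength_lipschitz.
Qed.

End arclength_parametrization.

(** * Line integrals along curves through a point *)

Lemma closed_within_preimage (T S : topologicalType) (A : set T) (f : T -> S) (F : set S) :
  closed A -> {within A, continuous f} -> closed F -> closed (A `&` f @^-1` F).
Proof.
move=> cA /continuous_closedP/(_ F) cf /cf/closed_subspaceP[V cV VE].
by rewrite setIC -VE; exact: closedI.
Qed.

(** Start at the last time the function is at least r1, and stop at the first
    later time it is at most r2. *)
Lemma crossing_interval (R : realType) (u : R -> R) (a b r1 r2 : R) :
  a <= b -> {within `[a, b], continuous u} ->
  r1 <= u a -> r2 < r1 -> u b <= r2 ->
  exists p : R * R, [/\ a <= p.1 <= p.2, p.2 <= b, r1 <= u p.1, u p.2 <= r2 &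
    forall t, p.1 < t -> t < p.2 -> r2 < u t < r1].
Proof.
move=> ab cu ua r21 ub.
have [||t|s1 [/= s1ab us1] s1max] :=
    @closed_has_max R (`[a, b] `&` u @^-1` [set r | (r1 <= r)%R]) b.
- by apply: closed_within_preimage => //; exact: interval_closed.
- by exists a; split => //=; rewrite in_itv/= lexx.
- by case => /=; rewrite in_itv/= => /andP[].
move: s1ab; rewrite in_itv/= => /andP[as1 s1b].
have [||t|s2 [/= s2ab us2] s2min] :=
    @closed_has_min R (`[s1, b] `&` u @^-1` [set r | (r <= r2)%R]) s1.
- apply: closed_within_preimage; [exact: interval_closed| |exact: closed_le].
  apply: continuous_subspaceW cu => t /=; rewrite !in_itv/= => /andP[h1 h2].
  by rewrite h2 (le_trans as1).
- by exists b; split => //=; rewrite in_itv/= lexx s1b.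
- by case => /=; rewrite in_itv/= => /andP[].
move: s2ab; rewrite in_itv/= => /andP[s12 s2b].
exists (s1, s2); split => //=; rewrite ?as1// => t s1t ts2; apply/andP; split.
  rewrite ltNge; apply/negP => utr2.
  have : s2 <= t by apply: s2min; split => //=; rewrite in_itv/= (ltW s1t) (le_trans (ltW ts2)).
  by rewrite leNgt ts2.
rewrite ltNge; apply/negP => utr1.
have : t <= s1.
  by apply: s1max; split => //=; rewrite in_itv/= (le_trans as1 (ltW s1t)) (le_trans (ltW ts2)).
by rewrite leNgt s1t.
Qed.

(** The integral of a nonnegative function is a supremum over the simple
    functions below it, hence monotone for arbitrary functions.  This spares
    the measurability of compositions with arclength parametrizations. *)
Lemma ge0_le_integral_nonmeasurable d (T : measurableType d) (R : realType)
    (mu : {measure set T -> \bar R}) (D : set T) (f1 f2 : T -> \bar R) :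
  (forall x, D x -> (0 <= f1 x)%E) -> (forall x, D x -> (f1 x <= f2 x)%E) ->
  (\int[mu]_(x in D) f1 x <= \int[mu]_(x in D) f2 x)%E.
Proof.
move=> f10 f12; rewrite !(integral_mkcond D).
have h10 x : (0 <= (f1 \_ D) x)%E by exact: erestrict_ge0.
have h12 x : ((f1 \_ D) x <= (f2 \_ D) x)%E by apply: lee_restrict.
rewrite !ge0_integralTE//; last by move=> x; exact: le_trans (h12 x).
apply: le_ereal_sup => _ [g gf1 <-]; exists g => // x.
exact: le_trans (gf1 x) (h12 x).
Qed.

Section line_integral_near_point.
Variables (R : realType) (n : nat) (g : curve R n) (p : 'rV[R]_n) (r : R) (N : nat).
Hypotheses (rg : rectifiable g) (r0 : 0 < r) (N0 : (0 < N)%N).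
Hypothesis start : r <= `|g (curve_lo g) - p|.
Hypothesis hit : trace g p.
Variable rho : 'rV[R]_n -> \bar R.
Hypothesis rho_ge0 : forall x, (0 <= rho x)%E.
Hypothesis rho_ge : forall k x, (k < N)%N -> `|x - p| < r / 2 ^+ k ->
  ((2 ^+ k.+1 / (N%:R * r))%:E <= rho x)%E.

(** The curve crosses each of the N annuli of radii r / 2^k and r / 2^(k+1)
    about p on its way to p.  Since the arclength parametrization is 1-Lipschitz,
    the crossing of the k-th annulus lasts at least r / 2^(k+1), and rho is at
    least 2^(k+1) / (N r) meanwhile: each annulus contributes at least 1 / N. *)
Lemma line_integral_through_point : (1 <= line_integral g rho)%E.
Proof.
rewrite /line_integral; set L := fine (curve_length g).
pose f := arclength_param g; pose u s := `|f s - p|.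
case: hit => tp /=; rewrite in_itv/= => /andP[lotp tphi] gtp.
pose sp := arclength g tp.
have sp0 : 0 <= sp by rewrite fine_ge0// arc_length_ge0.
have spL : sp <= L by apply: arclength_nondecreasing => //.
have usp : u sp = 0 by rewrite /u /f arclength_paramE// gtp subrr normr0.
have u0 : r <= u 0.
  by rewrite /u /f -(arclength_lo g) arclength_paramE ?curve_lo_le_hi.
have ulip s t : 0 <= s -> s <= t -> t <= L -> `|u t - u s| <= t - s.
  move=> s_0 st tL; apply: le_trans (ler_dist_dist _ _) _.
  rewrite opprB addrA subrK -[leRHS]ger0_norm ?subr_ge0//.
  apply: arclength_param_lipschitz => //; [exact: le_trans tL|exact: le_trans st].
have uc : {within `[0, sp], continuous u}.
  apply/subspace_continuousP => x; rewrite /= in_itv/= => /andP[x0 xsp].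
  apply/cvgrPdist_lt => e e0; apply/nbhs_ballP; exists e => //= y xy.
  rewrite in_itv/= => /andP[y0 ysp]; apply: le_lt_trans xy.
  have [xy|/ltW yx] := leP x y.
    by rewrite distrC [leRHS]distrC (ger0_norm (_ : 0 <= y - x)) ?subr_ge0// ulip// (le_trans ysp).
  by rewrite (ger0_norm (_ : 0 <= x - y)) ?subr_ge0// ulip// (le_trans xsp).
have dp k : (0 : R) < 2 ^+ k by rewrite exprn_gt0.
have rk k : r / 2 ^+ k.+1 < r / 2 ^+ k.
  by rewrite ltr_pM2l// ltf_pV2 ?posrE// exprS ltr_pMl// ltr1n.
have rmono j k : (j <= k)%N -> r / 2 ^+ k <= r / 2 ^+ j.
  by move=> jk; rewrite ler_pM2l// lef_pV2 ?posrE// ler_weXn2l// ler1n.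
have /choice[I IP] : forall k, exists q : R * R, [/\ 0 <= q.1 <= q.2, q.2 <= sp,
    r / 2 ^+ k <= u q.1, u q.2 <= r / 2 ^+ k.+1 &
    forall t, q.1 < t -> t < q.2 -> r / 2 ^+ k.+1 < u t < r / 2 ^+ k].
  move=> k; apply: crossing_interval => //.
    by apply: le_trans u0; rewrite ler_pdivrMr// ler_peMr ?(ltW r0)// exprn_ege1// ler1n.
  by rewrite usp divr_ge0// ltW.
pose c k : R := 2 ^+ k.+1 / (N%:R * r).
have Nr0 : 0 < N%:R * r by rewrite mulr_gt0// ltr0n.
have c0 k : 0 <= c k by rewrite divr_ge0// ltW.
have lenI k : r / 2 ^+ k.+1 <= (I k).2 - (I k).1.
  have [/andP[h1 h2] h3 h4 h5 _] := IP k.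
  apply: le_trans (ulip _ _ h1 h2 (le_trans h3 spL)).
  rewrite distrC; apply: le_trans (ler_norm _).
  apply: (@le_trans _ _ (r / 2 ^+ k - r / 2 ^+ k.+1)); last exact: lerB.
  by rewrite exprS invfM; lra.
pose h s := (\sum_(k < N) (c k * \1_(`](I k).1, (I k).2[%classic : set R) s)%:E)%E.
apply: (@le_trans _ _ (\int[lebesgue_measure]_(s in `[0%R, L]) h s)%E).
  rewrite ge0_integral_sum//=; last 2 first.
  - move=> k; apply/measurable_EFinP; apply: measurable_funM => //.
  - by move=> k s _; rewrite lee_fin mulr_ge0.
  apply: (@le_trans _ _ (\sum_(k < N) (N%:R^-1 : R)%:E)%E).
    by rewrite sumEFin sumr_const card_ord -[X in (_ <= X%:E)%E]mulr_natr mulVf// pnatr_eq0 -lt0n.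
  apply: lee_sum => k _; under eq_integral do rewrite EFinM.
  rewrite ge0_integralZl_EFin//=; last first.
    exact/measurable_EFinP/measurable_indic.
  rewrite integral_indic//= setIidl; last first.
    have [/andP[h1 h2] h3 _ _ _] := IP k.
    move=> s /=; rewrite !in_itv/= => /andP[s1 s2].
    by rewrite (le_trans h1 (ltW s1)) (le_trans (ltW s2) (le_trans h3 spL)).
  have I12 : (I k).1 < (I k).2.
    by rewrite -subr_gt0; apply: lt_le_trans (lenI k); rewrite divr_gt0.
  rewrite lebesgue_measure_itv/= lte_fin I12 -EFinB -EFinM lee_fin.
  apply: le_trans (ler_wpM2l (c0 k) (lenI k)).
  rewrite /c [leRHS](_ : _ = N%:R^-1)//.
  by field; rewrite (gt_eqF r0) (gt_eqF (dp _)) pnatr_eq0 -lt0n N0.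
apply: ge0_le_integral_nonmeasurable => s; rewrite /= in_itv/= => /andP[s0 sL].
  by apply: sume_ge0 => k _; rewrite lee_fin mulr_ge0.
have [[k sI]|noI] := pselect (exists k : 'I_N, s \in `](I k).1, (I k).2[).
  rewrite /h (bigD1 k)//= big1 ?adde0.
    rewrite indicE mem_set ?mulr1//.
    apply: (rho_ge (ltn_ord k)).
    move: sI; rewrite in_itv/= => /andP[sI1 sI2].
    by have [_ _ _ _ /(_ s sI1 sI2)/andP[]] := IP k.
  move=> j jk; rewrite indicE memNset ?mulr0//= => sJ.
  move: sI sJ; rewrite !in_itv/= => /andP[sI1 sI2] /andP[sJ1 sJ2].
  have [_ _ _ _ /(_ s sI1 sI2)/andP[k1 k2]] := IP k.
  have [_ _ _ _ /(_ s sJ1 sJ2)/andP[j1 j2]] := IP j.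
  move/negP: jk; apply; apply/eqP/val_inj => /=.
  (* the annuli are disjoint, so a time belongs to at most one crossing *)
  case: (ltngtP j k) => // h'; exfalso.
    by have := rmono _ _ h'; rewrite leNgt (lt_trans j1).
  by have := rmono _ _ h'; rewrite leNgt (lt_trans k1).
rewrite /h big1// => k _; rewrite indicE memNset ?mulr0//= => sI.
by apply: noI; exists k.
Qed.

End line_integral_near_point.

(** * Curves through a countable set have modulus zero *)

Lemma poweRVn_expn (R : realType) n (y : \bar R) : (0 < n)%N -> (0 <= y)%E ->
  (poweR y n%:R^-1 ^+ n)%E = y.
Proof.
move=> n0; have nR0 : (n%:R : R) != 0 by rewrite pnatr_eq0 -lt0n.
case: y => [y| |//] y0.
  by rewrite poweR_EFin -EFin_expe -powR_mulrn ?powR_ge0// -powRrM mulVf// powRr1.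
rewrite poweRyr ?invr_eq0//; case: n n0 {nR0} => // n _; elim: n => [//|n ih].
by rewrite expeS ih mulyy.
Qed.

Lemma lebesgue_Rn_ball (R : realType) n (x : 'rV[R]_n) (e : R) : 0 < e ->
  lebesgue_Rn R n (ball x e) = ((e *+ 2) ^+ n)%:E.
Proof.
move=> e0; elim: n x => [|n ih] x.
  rewrite /= diracE expr0 mem_set//; split => // i; by case.
rewrite [LHS]/= /lebesgue_consRn /pushforward.
rewrite (consRn_ball (x : 'rV[R]_(1 + n)) e0).
rewrite product_measure1E; last 2 first.
- exact: measurable_ball.
- by apply: open_borelRn; exact: (@ball_open R 'rV[R]_n).
rewrite exprS EFinM; congr (_ * _)%E; last exact: ih.
exact: (@lebesgue_measure_ball R _ _ (ltW e0)).
Qed.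

Section modulus_through_countable.
Variables (R : realType) (n : nat) (C : set 'rV[R]_n) (G : set (curve R n)).
Hypotheses (hn : (2 <= n)%N) (cC : countable C).
Hypothesis far : forall p, C p ->
  exists2 r : R, 0 < r & forall g, G g -> trace g p -> r <= `|g (curve_lo g) - p|.
Hypothesis through : forall g, G g -> exists2 p, C p & trace g p.

Let mballRn (x : 'rV[R]_n) e : measurable (ball x e : set (borelRn R n)).
Proof. by apply: open_borelRn; exact: (@ball_open R 'rV[R]_n). Qed.

Let few_layers (e : R) : 0 < e ->
  exists2 N, (0 < N)%N & N%:R * (4 / N%:R) ^+ n <= e.
Proof.
move=> e0; pose N := (Num.truncn (4 ^+ n / e)).+1.
have N0 : (0 : R) < N%:R by rewrite ltr0n.
have N1 : (1 : R) <= N%:R by rewrite ler1n.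
exists N => //; rewrite exprMn exprVn.
apply: (@le_trans _ _ (4 ^+ n / N%:R)).
  rewrite mulrCA ler_wpM2l ?exprn_ge0// ler_pdivrMr ?exprn_gt0//.
  case: n hn => [//|[//|m]] _.
  by rewrite !exprS mulKf ?gt_eqF// ler_peMr ?(ltW N0)// exprn_ege1.
by rewrite ler_pdivrMr// -ler_pdivrMl// mulrC ltW// truncnS_gt.
Qed.

(** About the m-th point p_m of C, charge the balls of radius r_m / 2^k, k < N,
    with the constants c = 2^(k+1) / (N r_m) of line_integral_through_point.
    Each of them has total mass c^n (2 r_m / 2^k)^n = (4 / N)^n, so the N layers
    weigh at most 4^n / N because n >= 2, which is as small as desired.
    Taking rho to be the n-th root of the sum S of all the c^n, rather than the
    sum of the densities, makes the integral of rho^n additive over all points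
    and layers while rho still dominates every single c on its ball. *)
Lemma modulus_through_countable_le e : 0 < e -> (modulus G <= e%:E)%E.
Proof.
move=> e0; have /countable_injP[h hP] := cC.
have hinj p q : C p -> C q -> h p = h q -> p = q.
  by move=> Cp Cq; apply: hP; rewrite inE.
(* for each m: the point of index m (if any), its radius, its number of layers *)
have /choice[d dP] : forall m, exists q : 'rV[R]_n * R * nat,
    [/\ 0 < q.1.2, (0 < q.2)%N, q.2%:R * (4 / q.2%:R) ^+ n <= e / (2 ^ m.+1)%:R &
      forall p, C p -> h p = m -> p = q.1.1 /\
        forall g, G g -> trace g p -> q.1.2 <= `|g (curve_lo g) - p|].
  move=> m; have [|N N0 Ne] := @few_layers (e / (2 ^ m.+1)%:R).
    by rewrite divr_gt0// ltr0n expn_gt0.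
  have [[p [Cp hp]]|noC] := pselect (exists p, C p /\ h p = m).
    have [r r0 rP] := far Cp; exists (p, r, N); split => //= p' Cp' hp'.
    have -> : p' = p by apply: hinj => //; rewrite hp hp'.
    by split.
  exists (0, 1, N); split => //= p Cp hp; exfalso.
  by apply: noC; exists p.
pose p m := (d m).1.1; pose r m := (d m).1.2; pose N m := (d m).2.
have r0 m : 0 < r m by have [] := dP m.
have N0 m : (0 < N m)%N by have [] := dP m.
have NR0 m : (0 : R) < (N m)%:R by rewrite ltr0n.
pose c m k : R := 2 ^+ k.+1 / ((N m)%:R * r m).
have c0 m k : 0 <= c m k by rewrite divr_ge0 ?exprn_ge0// mulr_ge0// ltW.
pose F m (x : borelRn R n) : \bar R :=
  (\sum_(k < N m) (c m k ^+ n)%:E * (\1_(ball (p m) (r m / 2 ^+ k) : set (borelRn R n)) x)%:E)%E.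
have F0 m x : (0 <= F m x)%E.
  by apply: sume_ge0 => k _; rewrite -EFinM lee_fin mulr_ge0// exprn_ge0.
have mF m : measurable_fun setT (F m).
  apply: emeasurable_sum => k; apply: measurable_funeM.
  by apply/measurable_EFinP; exact: measurable_indic.
pose S (x : borelRn R n) : \bar R := (\sum_(m <oo) F m x)%E.
have S0 x : (0 <= S x)%E by exact: nneseries_ge0.
have mS : measurable_fun setT S by apply: ge0_emeasurable_sum => //.
have n0 : (n%:R : R) != 0 by rewrite pnatr_eq0; case: n hn.
pose rho (x : borelRn R n) : \bar R := poweR (S x) (n%:R^-1).
have rhoX x : (rho x ^+ n)%E = S x.
  by apply: poweRVn_expn; rewrite ?S0//; exact: ltnW.
apply: (@le_trans _ _ (\int[lebesgue_Rn R n]_x (rho x ^+ n))%E).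
  apply: ereal_inf_lbound; exists rho => //; split.
  - apply: (@measurableT_comp _ _ _ _ _ _ (fun y => poweR y n%:R^-1)) => //.
    exact: measurable_poweR.
  - by move=> x; exact: poweR_ge0.
  - move=> g Gg rg; have [q Cq gq] := through Gg.
    have [_ _ _ /(_ q Cq erefl)[qE /(_ g Gg gq) rle]] := dP (h q).
    apply: (@line_integral_through_point _ _ g q (r (h q)) (N (h q))) => //.
      by move=> x; exact: poweR_ge0.
    move=> k x kN xq; rewrite -/(c (h q) k) /rho.
    have -> : c (h q) k = powR (c (h q) k ^+ n) (n%:R^-1).
      by rewrite -powR_mulrn// -powRrM mulfV// powRr1.
    rewrite -poweR_EFin; apply: gt0_ler_poweR => //.
    + by rewrite in_itv/= leey lee_fin exprn_ge0.
    + by rewrite in_itv/= leey S0.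
    apply: (@le_trans _ _ (F (h q) x)).
      rewrite /F (bigD1 (Ordinal kN))//= indicE mem_set ?mule1 ?leeDl//.
        by apply: sume_ge0 => j _; rewrite -EFinM lee_fin mulr_ge0// exprn_ge0.
      by rewrite /p -qE -ball_normE /= distrC.
    rewrite /S (nneseries_split 0 (h q).+1)// add0n big_nat_recr//=.
    rewrite -addeA addeCA leeDl// adde_ge0//; last exact: nneseries_ge0.
    by apply: sume_ge0.
under eq_integral do rewrite rhoX.
rewrite integral_nneseries//.
have IF m : (\int[lebesgue_Rn R n]_x F m x <= 0 + (e / (2 ^ m.+1)%:R)%:E)%E.
  rewrite add0e ge0_integral_sum//; last 2 first.
  - move=> k; apply: measurable_funeM.
    by apply/measurable_EFinP; exact: measurable_indic.
  - by move=> k x _; rewrite -EFinM lee_fin mulr_ge0// exprn_ge0.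
  have [_ _ Ne _] := dP m.
  apply: (@le_trans _ _ ((N m)%:R * (4 / (N m)%:R) ^+ n)%:E); last by rewrite lee_fin.
  have -> : (N m)%:R * (4 / (N m)%:R) ^+ n = \sum_(k < N m) (4 / (N m)%:R : R) ^+ n.
    by rewrite sumr_const card_ord mulr_natl.
  rewrite -sumEFin.
  apply: lee_sum => k _; rewrite ge0_integralZl_EFin ?exprn_ge0//; last first.
    by apply/measurable_EFinP; exact: measurable_indic.
  rewrite integral_indic// setIT [X in (_ * X)%E](@lebesgue_Rn_ball R n (p m) (r m / 2 ^+ k)) ?divr_gt0 ?exprn_gt0//.
  rewrite -EFinM -exprMn lee_fin le_eqVlt; apply/orP; left; apply/eqP; congr (_ ^+ _).
  rewrite /c exprS -mulr_natr; field.
  by rewrite (gt_eqF (r0 m)) (gt_eqF (NR0 m)) gt_eqF ?exprn_gt0.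
apply: le_trans (lee_nneseries _ _) _.
- by move=> m _ _; apply: integral_ge0.
- by move=> m _; exact: IF.
apply: (le_trans (@epsilon_trick R (fun=> 0%E) e predT _ (ltW e0))) => //.
by rewrite eseries0// add0e.
Qed.

End modulus_through_countable.

(** * Curves crossing the packing meet two boundaries at once *)

Section packing_pieces.
Variables (R : realType) (n : nat) (D : nat -> set 'rV[R]_n).
Hypothesis hD : packing D.

(** The exterior of the container plays the same role as the packed domains:
    these pieces are disjoint open sets whose union is the complement of the
    residual set. *)
Definition piece (i : nat) : set 'rV[R]_n := if i is 0%N then ~` closure (D 0%N) else D i.

Lemma piece_complement x : (forall i, ~ piece i x) -> residual_set D x.
Proof.
move=> h; split; first by apply: contrapT; exact: (h 0%N).
by move=> [i /= i0 Dix]; apply: (h i); case: i i0 Dix.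
Qed.

Lemma boundary_open (A : set 'rV[R]_n) x : open A ->
  closure A x -> ~ A x -> boundary A x.
Proof. by move=> oA cAx nAx; split => // /interior_subset. Qed.

(** The closures of disjoint open sets meet only along the boundaries, and the
    boundary of the exterior of the container lies in that of the container. *)
Lemma closure_piece_boundary i j x : i != j ->
  closure (piece i) x -> closure (piece j) x ->
  boundary (D i) x /\ boundary (D j) x.
Proof.
have nbhsD k y : D k y -> nbhs y (D k) by move=> Dky; apply: open_nbhs_nbhs; split => //; exact: packing_open.
have outer k : (0 < k)%N -> closure (piece 0) x -> closure (D k) x ->
    boundary (D 0%N) x /\ boundary (D k) x.
  move=> k0 c0 ck.
  have nD0 : ~ D 0%N x.
    by move=> /nbhsD /c0[y [/= ncl /subset_closure]].
  split; apply: boundary_open => //; try exact: packing_open.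
    exact: closure_subset (packing_sub hD k0) _ ck.
  by move=> Dkx; apply: nD0; exact: packing_sub Dkx.
have inner k l : (0 < k)%N -> (0 < l)%N -> k != l -> closure (D k) x -> closure (D l) x ->
    boundary (D k) x.
  move=> k0 l0 kl ck cl; apply: boundary_open => //; first exact: packing_open.
  move=> /nbhsD /cl[y [Dly Dky]].
  by have : (D k `&` D l) y by []; rewrite (packing_disjoint hD).
case: i j => [|i] [|j] // ij ci cj.
- exact: outer.
- by have [] := outer i.+1 isT cj ci.
- by split; [exact: inner ci cj|apply: inner cj ci => //; rewrite eq_sym].
Qed.

(** Otherwise the closures of the pieces are disjoint along the curve, and what
    they miss of it is countable.  Giving each piece its own colour, and each
    remaining point of the trace its own colour, the parameter interval would be
    coloured with closed classes, hence with one colour by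
    closed_fibre_constant, whereas its ends lie in different pieces. *)
Lemma curve_meets_common_boundary (g : curve R n) :
  piece 1 (g (curve_lo g)) -> piece 0 (g (curve_hi g)) ->
  countable (residual_set D `&` trace g) ->
  exists2 p, (exists i j, [/\ i != j, boundary (D i) p & boundary (D j) p]) & trace g p.
Proof.
move=> g1 g0 /countable_injP[h hinj]; apply: contrapT => noC.
pose a := curve_lo g; pose b := curve_hi g.
have ab : a <= b := curve_lo_le_hi g.
have disj i j t : t \in `[a, b] -> closure (piece i) (g t) -> closure (piece j) (g t) -> i = j.
  move=> tab ci cj; apply/eqP/negPn/negP => ij; apply: noC; exists (g t).
    by exists i, j; have [] := closure_piece_boundary ij ci cj.
  by exists t.
have /choice[c cP] : forall x, exists c : nat + nat,
    (exists2 i, c = inl i & closure (piece i) x) \/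
    (c = inr (h x) /\ forall i, ~ closure (piece i) x).
  move=> x; have [[i ix]|no] := pselect (exists i, closure (piece i) x).
    by exists (inl i); left; exists i.
  by exists (inr (h x)); right; split => // i ix; apply: no; exists i.
have cpiece i t : t \in `[a, b] -> closure (piece i) (g t) -> c (g t) = inl i.
  move=> tab ci; case: (cP (g t)) => [[j -> cj]|[_ /(_ i)//]].
  by rewrite (disj i j t).
have fibre k : closed (`[a, b] `&` (fun t => pickle (c (g t))) @^-1` [set k]).
  have [[t0 [t0ab /= t0k]]|no] :=
      pselect ((`[a, b] `&` (fun t => pickle (c (g t))) @^-1` [set k]) !=set0); last first.
    by have /nonemptyPn -> := no; exact: closed0.
  have cE t : (pickle (c (g t)) = k) <-> c (g t) = c (g t0).
    by rewrite -t0k; split => [/(pcan_inj pickleK)|->].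
  have gc : {within `[a, b], continuous g} by exact: curve_continuous.
  have cab : closed (`[a, b] : set R) by exact: interval_closed.
  case: (cP (g t0)) => [[i ci gt0i]|[ch gt0]].
    rewrite [X in closed X](_ : _ = `[a, b] `&` g @^-1` closure (piece i)).
      by apply: closed_within_preimage => //; exact: closed_closure.
    apply/seteqP; split => t [tab] /=; rewrite cE ci.
      by case: (cP (g t)) => [[j -> cj] [<-]|[->]].
    by move=> cit; split => //; exact: cpiece.
  rewrite [X in closed X](_ : _ = `[a, b] `&` g @^-1` [set g t0]).
    apply: closed_within_preimage => //.
    exact/accessible_closed_set1/hausdorff_accessible/norm_hausdorff.
  apply/seteqP; split => t [tab] /=; rewrite cE ch; last first.
    by move=> ->; rewrite ch; split.
  case: (cP (g t)) => [[j -> cj]//|[-> gt [hE]]].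
  have inS s : s \in `[a, b] -> (forall i, ~ closure (piece i) (g s)) -> g s \in residual_set D `&` trace g.
    move=> sab ns; rewrite inE; split; last by exists s.
    by apply: piece_complement => i /subset_closure; exact: ns.
  by split => //; apply: hinj => //; apply: inS.
have := closed_fibre_constant fibre (lexx a) ab (lexx b).
move=> /(pcan_inj pickleK); rewrite (cpiece 1%N) ?(cpiece 0%N)//.
- by rewrite in_itv/= lexx ab.
- exact: subset_closure.
- by rewrite in_itv/= lexx ab.
- exact: subset_closure.
Qed.

End packing_pieces.

(** * The curves joining two parallel balls have positive modulus *)

Lemma ge0_integral_translation (R : realType) (c : R) (f : R -> \bar R) :
  measurable_fun setT f -> (forall x, (0 <= f x)%E) ->
  (\int[lebesgue_measure]_t f (c + t)%R = \int[lebesgue_measure]_t f t)%E.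
Proof.
move=> mf f0.
pose shift : measurableTypeR R -> measurableTypeR R := +%R c.
have mc : measurable_fun setT shift by exact: (@measurable_funD _ _ R setT (cst c) id).
have f0' : {in [set: measurableTypeR R], forall x, (0 <= f x)%E} by move=> x _; exact: f0.
etransitivity.
  exact/esym/(ge0_integral_pushforward mc (@lebesgue_measure R) measurableT mf f0').
pose nu := measure_function_pushforward__canonical__measure_function_Measure
  (@lebesgue_measure R) mc.
apply: (@eq_measure_integral _ _ _ _ (@lebesgue_measure R) nu) => A mA _; apply/esym.
apply: (@lebesgue_measure_unique R nu) mA => _ [[a b] _ <-].
rewrite /pushforward /= [X in _ = lebesgue_measure X](_ : _ = `](a - c), (b - c)]%classic).
  rewrite !lebesgue_measure_itv/= !lte_fin ltrD2r; case: ifP => // _.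
  by rewrite -!EFinB opprB addrA subrK.
by apply/seteqP; split => t /=; rewrite /shift !in_itv/= ltrBlDl lerBrDl.
Qed.

Lemma measurable_expe d (T : measurableType d) (R : realType) (f : T -> \bar R) k :
  measurable_fun setT f -> measurable_fun setT (fun x => (f x ^+ k)%E).
Proof.
move=> mf; elim: k => [|k ih]; first exact: measurable_cst.
by under eq_fun do rewrite expeS; exact: emeasurable_funM.
Qed.

Section vertical_segment.
Variables (R : realType) (m : nat).
Implicit Types (y : 'rV[R]_m) (s t : R).

Definition rise y t : 'rV[R]_m.+1 := consRn (t, y).

Lemma rise_dist y s t : rise y t - rise y s = rise 0 (t - s).
Proof.
rewrite /rise /consRn/=; apply/matrixP => i j; rewrite !mxE.
by case: splitP => k _; rewrite !mxE ?subrr// -mulrnBl.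
Qed.

Lemma enorm_rise0 t : enorm (rise 0 t) = `|t|.
Proof.
rewrite /enorm big_ord_recl big1 ?addr0; last first.
  move=> i _; rewrite (_ : lift ord0 i = rshift 1 i); last exact: val_inj.
  by rewrite /rise /consRn/= (@row_mxEr _ 1 1 m) mxE expr0n.
rewrite (_ : (rise 0 t) ord0 ord0 = t) ?sqrtr_sqr//.
by have := consRnK (t, 0 : 'rV[R]_m); rewrite /unconsRn => -[].
Qed.

Lemma enorm_rise y s t : enorm (rise y t - rise y s) = `|t - s|.
Proof. by rewrite rise_dist enorm_rise0. Qed.

Lemma continuous_rise y : continuous (rise y).
Proof.
move=> t; apply/cvgrPdist_lt => e e0; apply/nbhs_ballP; exists e => //= s.
by apply: le_lt_trans; apply: le_trans (mx_norm_le_enorm _) _; rewrite enorm_rise.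
Qed.

Lemma measurable_rise y :
  measurable_fun setT (rise y : measurableTypeR R -> borelRn R m.+1).
Proof.
apply: (@measurableT_comp _ _ _ _ _ _ (@consRn R m)) => //.
  exact: measurable_consRn.
Qed.

Lemma arc_length_rise y s t : s <= t -> arc_length (rise y) s t = (t - s)%:E.
Proof.
move=> st; apply/eqP; rewrite eq_le; apply/andP; split.
  apply: arc_length_le => q sqt; rewrite lee_fin.
  elim: q s st sqt => [|x q ih] s st sqt /=; first by rewrite subr_ge0.
  have sx : s < x by case: sqt => /= /andP[].
  have xqt := itv_partition_cons sqt.
  have := ih x (itv_partition_le xqt) xqt.
  by rewrite enorm_rise gtr0_norm ?subr_gt0//; lra.
apply: le_trans (chord_le_arc_length _ st).
by rewrite enorm_rise ger0_norm// subr_ge0.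
Qed.

Lemma ball_rise y y' t e : 0 < e -> ball y e y' -> ball (rise y t) e (rise y' t).
Proof.
move=> e0 yy'; have [h1 h2] := consRnK (t, y).
suff : (@consRn R m @^-1` (ball (rise y t) e : set 'rV[R]_(1 + m))) (t, y') by [].
rewrite (consRn_ball (rise y t : 'rV[R]_(1 + m)) e0); split => /=.
  by rewrite /rise h1; exact: ballxx.
by move: h2; rewrite /= /rise => ->.
Qed.

Variables (c L : R).
Hypothesis L0 : 0 < L.

Let cL : c <= c + L. Proof. by rewrite lerDl ltW. Qed.

Let rise_within y : {within `[c, c + L], continuous (rise y)}.
Proof. by apply: continuous_subspaceT; exact: continuous_rise. Qed.

Definition segment y : curve R m.+1 := Curve cL (@rise_within y).

Lemma length_segment y : curve_length (segment y) = L%:E.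
Proof. by rewrite /curve_length/= arc_length_rise// addrAC subrr add0r. Qed.

Lemma rectifiable_segment y : rectifiable (segment y).
Proof. by rewrite /rectifiable length_segment ltry. Qed.

Lemma line_integral_segment y rho :
  line_integral (segment y) rho =
  (\int[lebesgue_measure]_(t in `[0%R, L]) rho (rise y (c + t)%R))%E.
Proof.
rewrite /line_integral length_segment/=; apply: eq_integral => t.
rewrite inE/= in_itv/= => /andP[t0 tL]; congr rho.
transitivity (arclength_param (segment y) (arclength (segment y) (c + t))).
  by congr arclength_param; rewrite /arclength/= arc_length_rise ?lerDl//= addrAC subrr add0r.
by rewrite (arclength_paramE (rectifiable_segment y))//= ?lerDl// lerD2l.
Qed.

End vertical_segment.

(** A substitute for the inequality of Hoelder: x is at most d, or else x^m is
    at least d^m. *)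
Lemma le_add_expe (R : realType) (m : nat) (d : R) (x : \bar R) : 0 < d -> (0 <= x)%E ->
  (x <= d%:E + (d ^- m)%:E * x ^+ m.+1)%E.
Proof.
move=> d0; case: x => [x| |//] x0; last first.
  suff -> : (+oo ^+ m.+1 = +oo :> \bar R)%E.
    by rewrite gt0_muley ?lte_fin ?invr_gt0 ?exprn_gt0// addey.
  by elim: m => [//|m ih]; rewrite expeS ih mulyy.
rewrite -EFin_expe -EFinM -EFinD lee_fin.
have [xd|/ltW dx] := leP x d.
  by rewrite (le_trans xd)// lerDl mulr_ge0 ?exprn_ge0// invr_ge0 exprn_ge0// ltW.
apply: (@le_trans _ _ (d ^- m * x ^+ m.+1)); last by rewrite lerDr ltW.
rewrite mulrC ler_pdivlMr ?exprn_gt0// exprS ler_wpM2l//.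
by rewrite lerXn2r// nnegrE ltW.
Qed.

Section modulus_lower_bound.
Variables (R : realType) (m : nat) (c L e : R) (y0 : 'rV[R]_m).
Hypotheses (L0 : 0 < L) (e0 : 0 < e).
Variables F1 F2 : set 'rV[R]_m.+1.
Hypothesis sub1 : ball (rise y0 c) e `<=` F1.
Hypothesis sub2 : ball (rise y0 (c + L)) e `<=` F2.

(* with this d, the term d of le_add_expe integrates to 1/2 over the segment *)
Let d : R := (L *+ 2)^-1.
Let d0 : 0 < d. Proof. by rewrite invr_gt0 mulrn_wgt0. Qed.

(** The vertical segment over y joins F1 to F2 and so has rho-length at
    least 1; by le_add_expe at least half of it comes from rho^(m+1). *)
Let fibre_bound (rho : borelRn R m.+1 -> \bar R) y :
  admissible (curves_joining F1 F2) rho -> ball y0 e y ->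
  ((d ^+ m / 2)%:E <= \int[lebesgue_measure]_t (rho (rise y t) ^+ m.+1))%E.
Proof.
move=> [mrho rho0 adm] yb.
have joins : curves_joining F1 F2 (segment c L0 y).
  by split; [apply: sub1|apply: sub2]; exact: ball_rise.
have := adm _ joins (rectifiable_segment c L0 y).
rewrite line_integral_segment => le1.
have mf : measurable_fun setT (fun t : R => rho (rise y t)).
  by apply: measurableT_comp => //; exact: measurable_rise.
have mfc : measurable_fun setT (fun t : R => rho (rise y (c + t))).
  apply: (@measurableT_comp _ _ _ _ _ _ (fun t : R => rho (rise y t))) => //.
  exact: measurable_funD.
have psi0 t : (0 <= rho (rise y t) ^+ m.+1)%E by exact: expe_ge0.
set I := (\int[lebesgue_measure]_t _)%E.
have : (1 <= (2^-1 : R)%:E + (d ^- m)%:E * I)%E.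
  apply: (le_trans le1).
  apply: (@le_trans _ _ (\int[lebesgue_measure]_(t in `[0%R, L])
     (d%:E + (d ^- m)%:E * rho (rise y (c + t)%R) ^+ m.+1))%E).
    apply: ge0_le_integral_nonmeasurable => t _ //.
    exact: le_add_expe.
  have mpsi : measurable_fun setT (fun t : R => (rho (rise y (c + t)%R) ^+ m.+1)%E).
    exact: measurable_expe.
  rewrite ge0_integralD//=; last 3 first.
  - by move=> t _; rewrite lee_fin ltW.
  - move=> t _; apply: mule_ge0; last exact: psi0.
    by rewrite lee_fin invr_ge0 exprn_ge0// ltW.
  - by apply: measurable_funeM; exact: measurable_funTS.
  rewrite integral_cst//= lebesgue_measure_itv/= lte_fin L0 sube0.
  apply: leeD.
    by rewrite -EFinM lee_fin (_ : d * L = 2^-1)// /d; field; rewrite gt_eqF.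
  rewrite ge0_integralZl_EFin//; last 3 first.
  - by move=> x _; exact: psi0.
  - exact: measurable_funTS.
  - by rewrite invr_ge0 exprn_ge0// ltW.
  rewrite lee_pmul2l ?lte_fin ?invr_gt0 ?exprn_gt0//.
  rewrite /I -(ge0_integral_translation c)//; last exact: measurable_expe.
  by apply: ge0_subset_integral => // x _; exact: psi0.
have I0 : (0 <= I)%E by apply: integral_ge0 => t _; exact: psi0.
case: I I0 => [J| |//] J0; last by rewrite leey.
rewrite -EFinM -EFinD !lee_fin => h.
have dm0 : 0 < d ^+ m by rewrite exprn_gt0.
have : 2^-1 <= J / d ^+ m by rewrite mulrC; lra.
by rewrite ler_pdivlMr// mulrC.
Qed.

(** Integrate fibre_bound over the ball of base points y, by Tonelli. *)
Lemma modulus_joining_gt0 : (0 < modulus (curves_joining F1 F2))%E.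
Proof.
have k0 : 0 < d ^+ m / 2 * (e *+ 2) ^+ m.
  by rewrite mulr_gt0 ?divr_gt0 ?exprn_gt0// mulrn_wgt0.
apply: (@lt_le_trans _ _ (d ^+ m / 2 * (e *+ 2) ^+ m)%:E); first by rewrite lte_fin.
apply: le_ereal_inf_tmp => _ [rho adm <-]; have [mrho rho0 _] := adm.
pose psi (x : borelRn R m.+1) : \bar R := (rho x ^+ m.+1)%E.
have mpsi : measurable_fun setT psi by exact: measurable_expe.
have psi0 : {in [set: borelRn R m.+1], forall x, (0 <= psi x)%E}.
  by move=> x _; exact: expe_ge0.
have -> : (\int[lebesgue_Rn R m.+1]_x (rho x ^+ m.+1) =
    \int[lebesgue_Rn R m]_y \int[lebesgue_measure]_t psi (rise y t))%E.
  etransitivity.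
    exact: (ge0_integral_pushforward (@measurable_consRn R m)
      (lebesgue_measure \x lebesgue_Rn R m)%E measurableT mpsi psi0).
  rewrite preimage_setT.
  apply: (fubini_tonelli2 (psi \o @consRn R m)).
  - by apply: measurableT_comp => //; exact: measurable_consRn.
  - by move=> x; exact: expe_ge0.
have mball : measurable (ball y0 e : set (borelRn R m)).
  by apply: open_borelRn; exact: (@ball_open R 'rV[R]_m).
apply: (@le_trans _ _ (\int[lebesgue_Rn R m]_(y in ball y0 e) (d ^+ m / 2)%:E)%E).
  by rewrite integral_cst//= EFinM [X in (_ <= _ * X)%E](@lebesgue_Rn_ball R m y0 e).
apply: (@le_trans _ _ (\int[lebesgue_Rn R m]_(y in ball y0 e)
   \int[lebesgue_measure]_t psi (rise y t))%E).
  apply: ge0_le_integral_nonmeasurable => y yb.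
    by rewrite lee_fin divr_ge0// exprn_ge0// ltW.
  exact: fibre_bound.
apply: ge0_subset_integral => //.
- apply: (measurable_fun_fubini_tonelli_G (psi \o @consRn R m)).
    by apply: measurableT_comp => //; exact: measurable_consRn.
  by move=> x; exact: expe_ge0.
- by move=> y _; apply: integral_ge0 => t _; exact: expe_ge0.
Qed.

End modulus_lower_bound.

(** * The residual set is not CNED *)

Lemma continuum_closed_ball (R : realType) n (x : 'rV[R]_n) (e : R) : 0 <= e ->
  continuum [set z | `|z - x| <= e].
Proof.
move=> e0; pose F := [set z : 'rV[R]_n | `|z - x| <= e].
split.
  apply: bounded_closed_compact.
    exists (e + `|x|); split; first exact: num_real.
    move=> M eM z /= zx; apply: le_trans (ltW eM).
    by rewrite -[z](subrK x) (le_trans (ler_normD _ _))// lerD2r.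
  apply: (@preimage_closed _ _ (fun z : 'rV[R]_n => `|z - x|) [set r | (r <= e)%R]).
    move=> z _; apply: (@continuous_comp _ _ _ (fun z : 'rV[R]_n => z - x) Num.norm).
      by apply: (@cvgB _ _ _ (nbhs z) _ id (cst x)); [exact: cvg_id|exact: cvg_cst].
    exact: norm_continuous.
  exact: closed_le.
rewrite [X in connected X](_ : _ =
    \bigcup_(z in F) ((fun t : R => x + t *: (z - x)) @` `[0, 1])).
  apply: bigcup_connected.
    exists x => z _; exists 0; first by rewrite /= in_itv/= lexx ler01.
    by rewrite scale0r addr0.
  move=> z _; apply: connected_continuous_connected; first exact: segment_connected.
  apply: continuous_subspaceT => t; apply: cvgD; first exact: cvg_cst.
  by apply: cvgZr_tmp; exact: cvg_id.
apply/seteqP; split => [z zF|_ [z /= zF [t /= + <-]]].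
  exists z => //; exists 1; first by rewrite /= in_itv/= lexx ler01.
  by rewrite scale1r addrC subrK.
rewrite in_itv/= => /andP[t0 t1].
rewrite addrAC subrr add0r normrZ ger0_norm//.
by rewrite -[leRHS]mul1r ler_pM.
Qed.

Lemma rise_rsubmx (R : realType) m (x : 'rV[R]_(1 + m)) : rise (rsubmx x) (x ord0 ord0) = x.
Proof.
rewrite -[RHS]hsubmxK; suff -> : lsubmx x = (x ord0 ord0)%:M by [].
apply/matrixP => i j; rewrite !ord1 !mxE mulr1n; congr (x _ _); exact: val_inj.
Qed.

Theorem proposition1p11 (R : realType) (n : nat) (hn : (2 <= n)%N)
    (D : nat -> set 'rV[R]_n) (hD : packing D)
    (hbd : forall i j : nat, i != j ->
       countable (boundary (D i) `&` boundary (D j))) :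
  ~ CNED (residual_set D).
Proof.
case: n hn D hD hbd => [//|m] hn D hD hbd cned.
have [x1 D1x1] := packing_nonempty hD 1%N.
have [e0 /= e0_gt0 e0D] : nbhs_ball x1 (D 1%N).
  by apply/nbhs_ballP; apply: open_nbhs_nbhs; split => //; exact: packing_open.
pose e := e0 / 2; have e_gt0 : 0 < e by rewrite divr_gt0.
have ee0 : e + e = e0 by rewrite -splitr.
have [M [_ /(_ (`|M| + 1))DM]] := packing_bounded hD 0%N.
have {}DM : D 0%N `<=` [set z | `|z| <= `|M| + 1].
  by apply: DM; rewrite (le_lt_trans (ler_norm _))// ltrDl.
pose c := x1 ord0 ord0; pose y0 := rsubmx (x1 : 'rV[R]_(1 + m)).
have x1E : rise y0 c = x1 by exact: rise_rsubmx.
(* high enough for the ball of radius e about x2 to clear the container *)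
pose L := `|M| + 1 + e + 1 + `|c|.
have L0 : 0 < L by rewrite /L; have := normr_ge0 M; have := normr_ge0 c; lra.
pose x2 := rise y0 (c + L).
pose F1 := [set z | `|z - x1| <= e]; pose F2 := [set z | `|z - x2| <= e].
have F1D : F1 `<=` D 1%N.
  move=> z; rewrite /F1 /= => zx; apply: e0D.
  by rewrite -ball_normE /= distrC; lra.
have F2D : F2 `<=` ~` closure (D 0%N).
  move=> z; rewrite /F2 /= => zx2 cz.
  have : `|z| <= `|M| + 1.
    have cle : closed [set z : 'rV[R]_m.+1 | `|z| <= `|M| + 1].
      apply: (@preimage_closed _ _ (fun z : 'rV[R]_m.+1 => `|z|) [set r | (r <= `|M| + 1)%R]); last exact: closed_le.
      by move=> ? _; exact: norm_continuous.
    by have := closure_subset DM cz; rewrite -(closure_id _).1.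
  apply/negP; rewrite -ltNge.
  have coord (v : 'rV[R]_m.+1) : `|v ord0 ord0| <= `|v|.
    by rewrite [leRHS]/Num.norm /= mx_normrE (le_bigmax _ _ (ord0, ord0)).
  apply: lt_le_trans (coord z).
  have := le_trans (coord (z - x2)) zx2.
  have x20 : x2 ord0 ord0 = c + L.
    by have := consRnK (c + L, y0); rewrite /unconsRn => -[].
  rewrite mxE [(- x2) _ _]mxE x20 ler_norml => /andP[h _].
  apply: lt_le_trans (ler_norm _).
  by have := ler_norm (- c); move: h; rewrite normrN /L; lra.
have pos : (0 < modulus (curves_joining F1 F2))%E.
  apply: (@modulus_joining_gt0 R m c L e y0 L0 e_gt0).
    by move=> z; rewrite x1E -ball_normE /= distrC => /ltW.
  by move=> z; rewrite -/x2 -ball_normE /= distrC => /ltW.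
have ne (x : 'rV[R]_m.+1) : [set z | `|z - x| <= e] !=set0.
  by exists x; rewrite /= subrr normr0 ltW.
have disj : F1 `&` F2 = set0.
  apply/seteqP; split => // z [/F1D D1z /F2D]; apply; apply: subset_closure.
  exact: packing_sub D1z.
have := cned F1 F2 (ne _) (ne _) (continuum_closed_ball x1 (ltW e_gt0))
  (continuum_closed_ball x2 (ltW e_gt0)) disj.
move: pos => /[swap] ->; rewrite ltNge => /negP; apply.
pose C := [set p | exists i j, [/\ i != j, boundary (D i) p & boundary (D j) p]].
have cC : countable C.
  rewrite (_ : C = \bigcup_(ij in [set ij : nat * nat | ij.1 != ij.2])
      (boundary (D ij.1) `&` boundary (D ij.2))).
    by apply: bigcup_countable => // -[i j] /= ij; exact: hbd.
  apply/seteqP; split => [p [i [j [ij bi bj]]]|p [[i j] /= ij [bi bj]]].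
    by exists (i, j).
  by exists i, j.
(* so the points of C keep a distance from F1, where the curves start *)
have D1C p : C p -> ~ D 1%N p.
  have aux i : i != 1%N -> boundary (D i) p -> ~ D 1%N p.
    move=> i1 [ci nintp] D1p; case: i i1 ci nintp => [|[//|i]] _ ci nintp.
      apply: nintp; apply: open_nbhs_nbhs; split; first exact: packing_open.
      exact: (packing_sub hD (i := 1%N) isT).
    have [y [Diy D1y]] := ci _ (open_nbhs_nbhs (conj (@packing_open _ _ _ hD 1%N) D1p)).
    by have : (D i.+2 `&` D 1%N) y by []; rewrite (packing_disjoint hD).
  move=> [i [j [ij bi bj]]]; have [i1|i1] := eqVneq i 1%N; last exact: aux bi.
  by apply: aux bj; rewrite -i1 eq_sym.
apply/lee_addgt0Pr => eps eps0; rewrite add0e.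
apply: (@modulus_through_countable_le R m.+1 C) => //.
  move=> p Cp; exists e => // g [[/= g1 _] _] _.
  have : e0 <= `|x1 - p|.
    rewrite leNgt; apply/negP => x1p; apply: (D1C p Cp); apply: e0D.
    by rewrite -ball_normE.
  move: g1; rewrite /F1 /= => g1.
  have := ler_distD (g (curve_lo g)) x1 p; rewrite distrC in g1; lra.
move=> g [[g1 g2] gS].
apply: curve_meets_common_boundary gS => //; [exact: F1D|exact: F2D].
Qed.
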